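(* For every integer $k$ with $1\leq k\leq 29$ and $\gcd(k,30)=1$, and for every positive integer $K$, $$\sum_{n=1}^{K}\sigma(30n)>\sum_{n=1}^{K}\sigma(30n+k).$$
   Context: For a positive integer $n$, $\sigma(n)$ denotes the sum of all positive divisors of $n$. *)

(* Defs.v *)
From mathcomp Require Import all_boot.

Definition sigma (n : nat) : nat := \sum_(d <- divisors n) d.

(* Main.v *)
(** Multiplying the divisors of [30] by [n] gives [sigma (30 n) >= 72 n], so it
    suffices to bound the right-hand side by [36 K (K + 1)].

    Put [M := 30 K + k].  The sum of the [sigma (30 n + k)] counts [e] over the
    pairs [(d, e)] with [d e <= M] and [d e = k] modulo [30].  For fixed [d], as
    [k] is coprime to [30], the admissible [e <= X := M / d] lie in one residue
    class modulo [30], and their sum is at most [(X + 15)^2 / 60].  From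
    [5 (X + 15)^2 <= 6 X^2 + 6750] and [\sum_d 1 / d^2 <= 5 / 3], the right-hand
    side is at most [(2 M^2 + 1350 M) / 60], which is small enough for
    [K >= 118].  For smaller [K], [sigma (30 n + k) < 72 n] holds termwise, by
    computation. *)
Require Import Defs.
From mathcomp Require Import all_boot all_order all_algebra.
From mathcomp Require Import zify ring lra.

Set Implicit Arguments.
Unset Strict Implicit.
Unset Printing Implicit Defensive.

(** The involution [d -> n / d] permutes the divisors. Indexing by [d] and summing the cofactor lets
    [d] be fixed later while the summand runs over a residue class. *)
Lemma sigma_cofactorE (n : nat) : 0 < n ->
  sigma n = \sum_(1 <= d < n.+1 | d %| n) n %/ d.
Proof.
move=> n0; rewrite -big_filter -(big_map (divn n) xpredT id) /=.
have divnK2 d : d %| n -> n %/ (n %/ d) = d.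
  by case/dvdnP => q E; move: n0; rewrite E muln_gt0 => /andP[q0 d0];
     rewrite mulnK // mulKn.
apply: perm_big; apply: uniq_perm; first exact: divisors_uniq.
  rewrite map_inj_in_uniq ?filter_uniq ?iota_uniq // => a b.
  rewrite !mem_filter => /andP[/divnK2 Ea _] /andP[/divnK2 Eb _] E.
  by rewrite -Ea E Eb.
move=> e; rewrite -dvdn_divisors //; apply/idP/mapP => [en|[d]].
  exists (n %/ e); last by rewrite divnK2.
  rewrite mem_filter mem_index_iota dvdn_div //= divn_gt0 ?(dvdn_gt0 n0) //.
  by rewrite (dvdn_leq n0 en) ltnS leq_div.
by rewrite mem_filter => /andP[dn _] ->; apply: dvdn_div.
Qed.

(** Multiplication by [n] embeds the divisors of [m] into those of [m * n]. *)
Lemma sigma_mul_ge (m n : nat) : 0 < m -> 0 < n -> sigma m * n <= sigma (m * n).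
Proof.
move=> m0 n0; rewrite /sigma big_distrl /=.
rewrite -(big_map (fun d => d * n) xpredT id) /=.
have s_uniq : uniq [seq d * n | d <- divisors m].
  rewrite map_inj_uniq ?divisors_uniq // => a b /eqP.
  by rewrite eqn_pmul2r // => /eqP.
have s_sub d : d \in [seq d * n | d <- divisors m] -> d \in divisors (m * n).
  case/mapP => e; rewrite -dvdn_divisors // => em ->.
  by rewrite -dvdn_divisors ?muln_gt0 ?m0 // dvdn_mul.
rewrite [leqRHS](bigID (mem [seq d * n | d <- divisors m])) /=.
apply: leq_trans (leq_addr _ _); rewrite -[leqRHS]big_filter.
rewrite (perm_big [seq d <- divisors (m * n) | d \in [seq d * n | d <- divisors m]]) //.
apply: uniq_perm => //; first by rewrite filter_uniq ?divisors_uniq.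
move=> d; rewrite mem_filter.
by case: (boolP (d \in [seq _ | _ <- _])) => // /s_sub ->.
Qed.

Lemma sum_72 (K : nat) : \sum_(1 <= n < K.+1) 72 * n = 36 * (K * K.+1).
Proof.
elim: K => [|K IH]; first by rewrite big_geq.
rewrite big_nat_recr //= IH; lia.
Qed.

Lemma sum_sigma_30_ge (K : nat) :
  36 * (K * K.+1) <= \sum_(1 <= n < K.+1) sigma (30 * n).
Proof.
rewrite -sum_72 big_nat [leqRHS]big_nat; apply: leq_sum => n /andP[n0 _].
have -> : 72 = sigma 30 by rewrite /sigma unlock.
exact: sigma_mul_ge.
Qed.

(** Strong induction: when [P X] holds, the other terms are at most [X - 30], and
    [(X + 15)^2 - (X - 15)^2 = 60 X] pays exactly for the term [X]. *)
Lemma sum_mod30_le (P : pred nat) (X : nat) :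
    (forall a b, P a -> P b -> a = b %[mod 30]) ->
  60 * \sum_(0 <= e < X.+1 | P e) e <= (X + 15) ^ 2.
Proof.
move=> Pmod; elim/ltn_ind: X => X IH.
have gap e : P X -> P e -> X - 29 <= e -> e < X -> False.
  by move=> PX Pe; have := Pmod _ _ PX Pe; lia.
rewrite big_mkcond big_nat_recr //= -big_mkcond /=.
case: (boolP (P X)) => PX; last first.
  rewrite addn0; case: X IH {gap PX} => [|X] IH; first by rewrite big_geq.
  by apply: leq_trans (IH X _) _ => //; nia.
rewrite (@big_cat_nat _ _ _ (X - 29)) //=; last lia.
rewrite [X in _ + X + _]big_nat_cond [X in _ + X + _]big_pred0; last first.
  by move=> e; apply/negP => /andP[/andP[h1 h2] Pe]; apply: (gap e).
rewrite addn0; case: (ltnP X 30) => hX.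
  (* Here [X] is the only possible nonzero term, and [4 * 15 * X <= (X + 15)^2]. *)
  rewrite (_ : X - 29 = 0); last lia.
  by rewrite big_geq // add0n; apply: leq_trans (nat_AGM2 X 15); lia.
rewrite (_ : X - 29 = (X - 30).+1); last lia.
have := IH (X - 30) ltac:(lia).
set S := \sum_(_ <= _ < _ | _) _; nia.
Qed.

Lemma coprime_mul_modI (q d a b : nat) :
  coprime d q -> d * a = d * b %[mod q] -> a = b %[mod q].
Proof.
move=> cdq; wlog le_ba : a b / b <= a.
  by move=> H; case/orP: (leq_total b a) => h E; [|symmetry]; apply: H.
move/eqP; rewrite eqn_mod_dvd ?leq_mul2l ?le_ba ?orbT //.
rewrite -mulnBr Gauss_dvdr; last by rewrite coprime_sym.
by rewrite -eqn_mod_dvd // => /eqP.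
Qed.

(** Any solution [e] forces [d] to be a unit modulo 30, so all solutions are congruent; for other
    [d] the sum is empty. *)
Lemma sum_cofactors_le (k d X : nat) : coprime k 30 ->
  60 * \sum_(0 <= e < X.+1 | d * e == k %[mod 30]) e <= (X + 15) ^ 2.
Proof.
move=> ck; apply: sum_mod30_le => a b /eqP Ea /eqP Eb.
apply: (@coprime_mul_modI 30 d); last by rewrite Ea Eb.
have : coprime (d * a) 30 by rewrite -coprime_modl Ea coprime_modl.
by rewrite coprimeMl => /andP[].
Qed.

Lemma sum_sigma_AP_le (k K : nat) : k < 30 ->
  \sum_(1 <= n < K.+1) sigma (30 * n + k) <=
  \sum_(1 <= d < (30 * K + k).+1)
     \sum_(0 <= e < ((30 * K + k) %/ d).+1 | d * e == k %[mod 30]) e.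
Proof.
move=> k30; set M := 30 * K + k.
have sigma_le n : 1 <= n < K.+1 -> sigma (30 * n + k) <=
    \sum_(1 <= d < M.+1) \sum_(0 <= e < (M %/ d).+1 | d * e == 30 * n + k) e.
  move=> hn; have nM : 30 * n + k <= M by rewrite /M; lia.
  have N0 : 0 < 30 * n + k by lia.
  rewrite sigma_cofactorE // [leqRHS](@big_cat_nat _ _ _ (30 * n + k).+1) //=.
  apply: leq_trans (leq_addr _ _).
  rewrite big_mkcond /=; apply: leq_sum => d _.
  case: ifP => // dN; rewrite -[leqRHS]big_filter.
  rewrite (bigD1_seq ((30 * n + k) %/ d)) ?filter_uniq ?iota_uniq //.
    exact: leq_addr.
  by rewrite mem_filter mulnC divnK // eqxx mem_index_iota ltnS leq_div2r.
apply: leq_trans (_ : _ <= \sum_(1 <= n < K.+1) \sum_(1 <= d < M.+1)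
   \sum_(0 <= e < (M %/ d).+1 | d * e == 30 * n + k) e) _.
  by rewrite big_nat [leqRHS]big_nat; apply: leq_sum.
rewrite exchange_big /=; apply: leq_sum => d _.
rewrite (exchange_big_dep (fun e => d * e == k %[mod 30])) /=; last first.
  by move=> n e _ /eqP ->; rewrite mulnC modnMDl.
apply: leq_sum => e _.
rewrite -big_filter big_const_seq count_predT size_filter iter_addn_0.
rewrite -[leqRHS]muln1 leq_mul2l; apply/orP; right.
(* A pair [(d, e)] determines [n], so it is counted at most once. *)
apply: leq_trans (_ : count_mem ((d * e - k) %/ 30) (index_iota 1 K.+1) <= 1).
  by apply: sub_count => n /= /eqP ->; rewrite addnK mulKn.
by rewrite count_uniq_mem ?iota_uniq // leq_b1.
Qed.

Import Order.TTheory GRing.Theory Num.Theory.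

(** Telescoping from [d = 2] on: [1 / d^2 < 1 / (d^2 - 1/4) = 2 / (2 d - 1) - 2 / (2 d + 1)]. The
    term [d = 1] is kept exact, whence [1 + 2/3]. *)
Lemma sum_inv_sqr_le (R : realFieldType) (D : nat) :
  (\sum_(1 <= d < D.+1) (d%:R ^- 2 : R) <= 5%:R / 3%:R)%R.
Proof.
suff H n : (\sum_(1 <= d < n.+2) (d%:R ^- 2 : R)
            <= 5%:R / 3%:R - 2%:R / (2 * n + 3)%:R)%R.
  case: D => [|D]; first by rewrite big_geq // divr_ge0.
  by apply: le_trans (H D) _; rewrite lerBlDr lerDl divr_ge0.
elim: n => [|n IH]; first by rewrite big_nat1 expr1n invr1 muln0 add0n; lra.
rewrite big_nat_recr //=; apply: le_trans (lerD IH (lexx _)) _.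
have -> : ((2 * n + 3)%:R = 2%:R * n%:R + 3%:R :> R)%R by ring.
have -> : ((2 * n.+1 + 3)%:R = 2%:R * n%:R + 5%:R :> R)%R by ring.
have -> : (n.+2%:R = n%:R + 2%:R :> R)%R by rewrite -natrD addn2.
have := ler0n R n; move: (n%:R)%R => x x0.
rewrite -subr_ge0.
have -> : (5%:R / 3%:R - 2%:R / (2%:R * x + 5%:R) -
  (5%:R / 3%:R - 2%:R / (2%:R * x + 3%:R) + (x + 2%:R) ^- 2) =
  ((2%:R * x + 3%:R) * (2%:R * x + 5%:R) * (x + 2%:R) ^+ 2)^-1)%R.
  by field; apply/and3P; split; apply: lt0r_neq0; lra.
by rewrite invr_ge0 !mulr_ge0 //; lra.
Qed.

Lemma sum_sqr_divn_le (M : nat) :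
  3 * \sum_(1 <= d < M.+1) (M %/ d) ^ 2 <= 5 * M ^ 2.
Proof.
rewrite -(ler_nat rat) (natrM _ 3) (natrM _ 5) natr_sum natrX.
have H : (\sum_(1 <= d < M.+1) ((M %/ d) ^ 2)%:R <=
          M%:R ^+ 2 * \sum_(1 <= d < M.+1) (d%:R ^- 2 : rat))%R.
  rewrite mulr_sumr big_nat [leRHS]big_nat; apply: ler_sum => d /andP[d0 _].
  rewrite natrX -expr_div_n lerXn2r ?nnegrE ?divr_ge0 //.
  by rewrite ler_pdivlMr ?ltr0n // -natrM ler_nat leq_divM.
have := sum_inv_sqr_le rat M; have := sqr_ge0 (M%:R : rat)%R.
move: H; set A := (\sum_(_ <= _ < _) _)%R; set B := (\sum_(_ <= _ < _) _)%R.
move: (_ ^+ 2)%R => C; nra.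
Qed.

Lemma sum_sigma_AP_bound (k K : nat) : k < 30 -> coprime k 30 ->
  60 * \sum_(1 <= n < K.+1) sigma (30 * n + k)
    <= 2 * (30 * K + k) ^ 2 + 1350 * (30 * K + k).
Proof.
move=> k30 ck; set M := 30 * K + k.
have H1 : 5 * (60 * \sum_(1 <= n < K.+1) sigma (30 * n + k)) <=
  \sum_(1 <= d < M.+1) (6 * (M %/ d) ^ 2 + 6 * 1125).
  apply: leq_trans (leq_mul (leqnn 5) (leq_mul (leqnn 60) (sum_sigma_AP_le K k30))) _.
  rewrite mulnA big_distrr; apply: leq_sum => d _.
  have := sum_cofactors_le d (M %/ d) ck; rewrite -/M.
  move: (M %/ d) (\sum_(_ <= _ < _ | _) _) => x S.
  (* The slack [6 x^2 + 6750 - 5 (x + 15)^2] is [(x - 75)^2]. *)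
  by have /= := leq_of_leqif (nat_AGM2 x 75); lia.
move: H1; rewrite big_split /= -big_distrr /= sum_nat_const_nat subSS subn0.
have := sum_sqr_divn_le M; nia.
Qed.

Lemma sigma_AP_small (k n : nat) : k < 30 -> coprime k 30 -> 0 < n < 118 ->
  sigma (30 * n + k) < 72 * n.
Proof.
move=> k30 ck /andP[n0 n118].
(* [foldr] replaces the locked big operator so that the check can be evaluated. *)
have check : all (fun n => all (fun k => coprime k 30 ==>
    (foldr addn 0 (divisors (30 * n + k)) < 72 * n)) (iota 0 30)) (iota 1 117).
  by vm_cast_no_check (erefl true).
have /(_ n) := allP check; rewrite mem_iota n0 n118 => /(_ isT) /allP /(_ k).
by rewrite mem_iota k30 ck => /(_ isT); rewrite /sigma -sumnE.
Qed.

Theorem theorem1p1 (k K : nat) (hk : 1 <= k <= 29) (hgcd : gcdn k 30 = 1)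
    (hK : 0 < K) :
  \sum_(1 <= n < K.+1) sigma (30 * n) > \sum_(1 <= n < K.+1) sigma (30 * n + k).
Proof.
have ck : coprime k 30 by apply/eqP.
have k30 : k < 30 by case/andP: hk.
apply: leq_trans (sum_sigma_30_ge K).
have [K118|K118] := ltnP K 118; last first.
  (* In the worst case [k = 29] this amounts to [41820 K + 40832 < 360 K^2], which first holds at
     [K = 118]. *)
  by have := sum_sigma_AP_bound K k30 ck; nia.
rewrite -sum_72 big_nat_recr // [X in _ < X]big_nat_recr //=.
(* The term [n = K] supplies the strictness. *)
rewrite -addnS leq_add ?sigma_AP_small ?hK //.
rewrite big_nat [leqRHS]big_nat; apply: leq_sum => n /andP[n0 nK].
by rewrite ltnW // sigma_AP_small // n0 (ltn_trans nK).
Qed.
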